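(* For each $N\in\mathbb{N}$ let $A_N$ be a Gaussian (GUE) $N\times N$ random matrix. Then for all $m\in\mathbb{N}$, $$\lim_{N\to\infty}\mathbb{E}\left[\operatorname{tr}(A_N^m)\right]=\frac{1}{2\pi}\int_{-2}^{2}x^m\sqrt{4-x^2}\,dx .$$
   Context: $\operatorname{tr}=\frac1N\operatorname{Tr}$ is the normalized trace on $N\times N$ matrices. A standard real Gaussian has mean $0$ and variance $1$; a standard complex Gaussian is $(X+iY)/\sqrt2$ with $X,Y$ independent standard real Gaussians. A Gaussian (GUE) $N\times N$ random matrix is $A_N=\frac1{\sqrt N}(a_{ij})_{i,j=1}^N$ such that $A_N=A_N^*$ (i.e. $a_{ij}=\overline{a_{ji}}$ for all $i,j$), the family $\{a_{ij}\mid i\ge j\}$ is independent, and each $a_{ij}$ is a standard Gaussian random variable, complex for $i\neq j$ and real for $i=j$. *)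

(* Defs.v *)
From HB Require Import structures.
From mathcomp Require Import all_boot all_order all_algebra finmap.
From mathcomp Require Import complex.
From mathcomp Require Import all_classical all_reals all_analysis.

Set Implicit Arguments.
Unset Strict Implicit.
Unset Printing Implicit Defensive.

Import Order.TTheory GRing.Theory Num.Theory.
Import numFieldNormedType.Exports.

Local Open Scope classical_set_scope.
Local Open Scope ring_scope.
Local Open Scope complex_scope.

Section Independence.
Context d (T : measurableType d) (R : realType) (P : probability T R).

Definition independent_family (I : choiceType) (D : set I)
    d' (U : measurableType d') (X : I -> T -> U) : Prop :=
  forall S : {fset I}, [set` S] `<=` D ->
  forall B : I -> set U, (forall i, i \in S -> measurable (B i)) ->
    P (\bigcap_(i in [set` S]) (X i @^-1` B i)) =
      (\prod_(i <- S) P (X i @^-1` B i))%E.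

Definition independent_pair d' (U : measurableType d')
    d'' (V : measurableType d'') (X : T -> U) (Y : T -> V) : Prop :=
  forall (B : set U) (C : set V), measurable B -> measurable C ->
    P (X @^-1` B `&` Y @^-1` C) = (P (X @^-1` B) * P (Y @^-1` C))%E.

End Independence.

Section ComplexRandomVariables.
Context d (T : measurableType d) (R : realType) (P : probability T R).

(* The Borel structure on R[i] is that of R * R through this map. *)
Definition reim (z : R[i]) : (R * R)%type := (complex.Re z, complex.Im z).

Definition complex_integrable (Z : T -> R[i]) : Prop :=
  P.-integrable setT (fun t => (complex.Re (Z t))%:E) /\
  P.-integrable setT (fun t => (complex.Im (Z t))%:E).

(* Meaningful only when [complex_integrable Z] holds, because of [fine]. *)
Definition complex_expectation (Z : T -> R[i]) : R[i] :=
  fine 'E_P[fun t => complex.Re (Z t)] +i* fine 'E_P[fun t => complex.Im (Z t)].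

Definition standard_gaussian (X : {RV P >-> R}) : Prop :=
  forall B : set R, measurable B -> distribution P X B = normal_prob 0 1 B.

Definition standard_real_gaussian (Z : T -> R[i]) : Prop :=
  exists X : {RV P >-> R}, standard_gaussian X /\ forall t, Z t = (X t)%:C.

Definition standard_complex_gaussian (Z : T -> R[i]) : Prop :=
  exists X Y : {RV P >-> R},
    [/\ standard_gaussian X, standard_gaussian Y, independent_pair P X Y &
        forall t, Z t = (X t +i* Y t) / (Num.sqrt 2)%:C].

Definition gue (N : nat) (A : T -> 'M[R[i]]_N) : Prop :=
  exists a : 'I_N -> 'I_N -> T -> R[i],
    [/\ forall t, A t = ((Num.sqrt N%:R)^-1)%:C *: \matrix_(i, j) a i j t,
        forall i j t, a i j t = conjc (a j i t),
        independent_family P [set ij : 'I_N * 'I_N | (ij.2 <= ij.1)%N]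
          (fun ij t => reim (a ij.1 ij.2 t)),
        forall i j, i != j -> standard_complex_gaussian (a i j) &
        forall i, standard_real_gaussian (a i i)].

End ComplexRandomVariables.

Definition normalized_trace (F : fieldType) (N : nat) (M : 'M[F]_N) : F :=
  N%:R^-1 * \tr M.

(* Main.v *)
Require Import Defs.
From HB Require Import structures.
From mathcomp Require Import all_boot all_order all_algebra finmap.
From mathcomp Require Import complex.
From mathcomp Require Import all_classical all_reals all_analysis.
From mathcomp Require Import measurable_realfun.
From mathcomp Require Import ring lra.
From mathcomp Require mpoly.
Import -(notations) mpoly.
Import Order.TTheory GRing.Theory Num.Theory.
Import numFieldNormedType.Exports.
Set Implicit Arguments.
Unset Strict Implicit.
Unset Printing Implicit Defensive.
Local Open Scope classical_set_scope.
Local Open Scope ring_scope.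
Local Open Scope complex_scope.

(** Write tr for the normalized trace.  The proof avoids the enumeration of
    pairings and uses the loop (Schwinger-Dyson) equations instead.  They close
    up on the mixed moments
      mu_N(r_1, ..., r_p) = E [tr A^(r_1) ... tr A^(r_p)].
    Gaussian integration by parts says E [A_ij F] = E [d_ij F], where d_ij is a
    derivation with d_ij A_kl = 1/N if (k, l) = (j, i) and 0 otherwise.  Applied
    to the first factor of A_ij (A^k)_ji, summed over i and j, it produces a sum
    of products of two traces when d_ij hits A^k, and a single trace, with two
    factors 1/N more, when d_ij hits another trace ([gue_trace_moments]):
      mu_N(k+1, s) = sum_(l < k) mu_N(l, k-1-l, s)
                     + N^-2 sum_i s_i mu_N(k + s_i - 1, s minus s_i).
    All moments on the right have smaller total degree.  By induction on the
    degree the N^-2 term disappears in the limit, and mu_N(r_1, ..., r_p) tends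
    to c_(r_1) ... c_(r_p), where c is defined by c_0 = 1, c_1 = 0 and
    c_(k+2) = sum_(j <= k) c_j c_(k-j) ([loop_recursion_limit]).  The asymptotic
    factorization of mixed moments comes out of the same induction, so that no
    variance estimate is required.

    It remains to see that the moments of the semicircle law satisfy the same
    recursion ([semicircle_moment_conv]).  Integrating an exact derivative gives
    the two-term relation (k+4) c_(k+2) = 4 (k+1) c_k, and this relation implies
    the quadratic one by a symmetrization argument ([convolution_of_ratio]).

    The integration by parts formula is obtained from N^2 independent real
    standard Gaussians, the real and imaginary parts of the entries
    ([gue_gaussian_indep]).  The entries of A are linear polynomials in these
    variables ([gue_poly_model]); the expectation of a monomial is a product of
    one-dimensional moments ([integral_prod_independent]), so that the formula
    reduces to the one-dimensional identity E X^(n+1) = n E X^(n-1)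
    ([gaussian_momentS]), and the derivations d_ij are combinations of partial
    derivatives of formal polynomials ([gue_deriv_poly]). *)

(** * Integration of exact derivatives *)

Lemma continuous_is_derive (R : realType) (F f : R -> R) :
  (forall x : R, is_derive x 1 F (f x)) -> continuous F.
Proof.
move=> dF x; apply/differentiable_continuous/derivable1_diffP.
by have [] := dF x.
Qed.

Lemma integral_is_derive (R : realType) (F f : R -> R) (a b : R) : a < b ->
  (forall x : R, is_derive x 1 F (f x)) -> continuous f ->
  (\int[lebesgue_measure]_(x in `[a, b]) (f x)%:E = (F b - F a)%:E)%E.
Proof.
move=> ab dF cf; have cF := continuous_is_derive dF.
rewrite (@continuous_FTC2 _ f F)// ?EFinB//.
- exact: continuous_subspaceT.
- split.
  + by move=> x _; have [] := dF x.
  + exact/cvg_at_right_filter/cF.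
  + exact/cvg_at_left_filter/cF.
- by move=> x _; rewrite derive1E; have [_ ->] := dF x.
Qed.

Lemma is_derive_exprn (R : realType) (f : R -> R) n (x df : R) :
  is_derive x 1 f df ->
  is_derive x 1 (fun y => f y ^+ n) (n%:R * f x ^+ n.-1 * df).
Proof.
move=> fdf; have -> : (fun y => f y ^+ n) = f ^+ n.
  by apply/funext => y; rewrite exprfctE.
exact: is_deriveX.
Qed.

(** The integrals over [-(n+1), n+1] are F(n+1) - F(-(n+1)), which tends to 0,
    and they tend to the integral over the line by dominated convergence. *)
Lemma integralT_is_derive_eq0 (R : realType) (F f : R -> R) :
  (forall x : R, is_derive x 1 F (f x)) -> continuous f ->
  (@lebesgue_measure R).-integrable setT (EFin \o f) ->
  F n.+1%:R @[n --> \oo] --> 0 -> F (- n.+1%:R) @[n --> \oo] --> 0 ->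
  \int[@lebesgue_measure R]_x f x = 0.
Proof.
move=> dF cf intf Fy FNy; set mu := lebesgue_measure.
pose I n : set R := `[(- n.+1%:R : R), n.+1%:R]%classic.
have mI n : measurable (I n) by exact: measurable_itv.
have mf := measurable_int mu intf.
have cvgI : (\int[mu]_(x in I n) (f x)%:E @[n --> \oo] --> \int[mu]_x (f x)%:E)%E.
  under eq_fun do rewrite integral_mkcond.
  apply: (@dominated_cvg _ _ _ mu setT measurableT
    (fun n => (EFin \o f) \_ (I n)) (EFin \o f) (fun x => `|(f x)%:E|%E)).
  - move=> n; apply/(measurable_restrictT _ (mI n)).
    exact: measurable_funTS.
  - move=> x _; apply: cvg_near_cst; near=> n.
    rewrite patchE mem_set// /I /= in_itv/= -ler_norml.
    apply: (@le_trans _ _ n%:R); last by rewrite ler_nat.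
    near: n; exact: nbhs_infty_ger.
  - by [].
  - by have := integrable_abse intf.
  - by move=> n x _; rewrite patchE; case: ifP => // _; rewrite abse0.
have cvg0 : (\int[mu]_(x in I n) (f x)%:E @[n --> \oo] --> 0)%E.
  under eq_fun => n.
    have n0 : - n.+1%:R < n.+1%:R :> R by rewrite gtrN.
    rewrite (integral_is_derive n0 dF cf); over.
  apply: cvg_EFin; first by apply: nearW.
  by rewrite -[0](subrr 0); apply: cvgB.
by rewrite /Rintegral (cvg_unique _ cvgI cvg0).
Unshelve. all: end_near. Qed.

(** * Moments of the standard normal density *)

Section gaussian_moments.
Context (R : realType).
Notation mu := (@lebesgue_measure R).
Notation phi := (@normal_pdf R 0 1).

Lemma normal_fun01E x : normal_fun 0 1 x = expR (- (x ^+ 2) / 2) :> R.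
Proof. by rewrite /normal_fun subr0 expr1n. Qed.

Lemma std_normal_pdfE x : phi x = normal_peak 1 * expR (- (x ^+ 2) / 2).
Proof. by rewrite normal_pdfE ?oner_eq0// normal_fun01E. Qed.

Lemma is_derive_pdf (x : R) : is_derive x 1 phi (- x * phi x).
Proof.
have -> : (phi : R -> R) = fun x => normal_peak 1 * expR (- (x ^+ 2) / 2).
  by apply/funext => y; exact: std_normal_pdfE.
have dg : is_derive x 1 (fun x : R => - (x ^+ 2) / 2) (- x).
  by apply: is_derive_eq; rewrite /GRing.scale/=; field.
have dE := @is_derive1_comp R expR (fun x : R => - (x ^+ 2) / 2) x _ _
  (is_derive_expR _) dg.
have dc : is_derive x 1 (cst (normal_peak 1 : R)) 0 by exact: is_derive_cst.
apply: (is_derive_eq (is_deriveM dc dE)); rewrite /GRing.scale/= /cst mulr0 addr0.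
by ring.
Qed.

(** Half of the exponential decay is spent on absorbing the power of x. The rest
    is a multiple of a normal density of variance 2, hence integrable. *)
Lemma norm_exprM_pdf_le n (x : R) : `|x ^+ n * phi x| <=
  (n`!%:R * expR 1 * normal_peak 1) * expR (- (x ^+ 2) / 4).
Proof.
rewrite std_normal_pdfE normrM normrX (@ger0_norm _ (normal_peak 1 * _)); last first.
  by rewrite mulr_ge0 ?normal_peak_ge0 ?expR_ge0.
have -> : - x ^+ 2 / 2 = - x ^+ 2 / 4 + - x ^+ 2 / 4 by field.
rewrite expRD mulrCA !mulrA ler_pM2r ?expR_gt0// [leRHS]mulrC -mulrA.
rewrite ler_wpM2l ?normal_peak_ge0//.
have xn : `|x| ^+ n <= n`!%:R * expR `|x|.
  case: n => [|n].
    by rewrite expr0 fact0 mul1r -[leLHS]expR0 ler_expR.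
  rewrite mulrC -ler_pdivrMr ?ltr0n ?fact_gt0//.
  by apply: le_trans (expR_ge1Dxn n (normr_ge0 x)); rewrite lerDr.
(* |x| <= 1 + x^2/4 because (|x|/2 - 1)^2 >= 0 *)
have ex : expR `|x| <= expR 1 * expR (x ^+ 2 / 4).
  rewrite -expRD ler_expR -[x ^+ 2]real_normK ?num_real// -subr_ge0.
  have -> : 1 + `|x| ^+ 2 / 4 - `|x| = (`|x| / 2 - 1) ^+ 2 by field.
  exact: sqr_ge0.
rewrite mulNr expRN -ler_pdivlMr ?invr_gt0 ?expR_gt0// invrK.
by apply: (le_trans xn); rewrite -mulrA ler_wpM2l//.
Qed.

Lemma measurable_exprM_pdf n :
  measurable_fun setT (fun x : R => x ^+ n * phi x).
Proof.
apply: measurable_funM; first exact: exprn_measurable.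
exact: measurable_normal_pdf.
Qed.

Lemma integrable_exprM_pdf n :
  mu.-integrable setT (fun x => (x ^+ n * phi x)%:E).
Proof.
have s0 : Num.sqrt 2 != 0 :> R by rewrite gt_eqF// sqrtr_gt0.
pose c : R := n`!%:R * expR 1 * normal_peak 1 / normal_peak (Num.sqrt 2).
have := integrableZl measurableT c (integrable_normal_pdf 0 (Num.sqrt 2 : R)).
apply: le_integrable => //; first by apply/measurable_EFinP; exact: measurable_exprM_pdf.
move=> x _; rewrite -EFinM lee_fin.
apply: le_trans (norm_exprM_pdf_le n x) _; apply: le_trans (ler_norm _).
rewrite normal_pdfE// /normal_fun subr0 sqr_sqrtr// /c.
rewrite mulrA divfK ?gt_eqF ?normal_peak_gt0//.
by rewrite (_ : 2 *+ 2 = 4) // -mulr_natr; ring.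
Qed.

(** The bound on the next power, x^(n+1) phi(x), gives a decay in 1/|x|. *)
Lemma cvg_exprM_pdf n (u : nat -> R) : (forall k, `|u k| = k.+1%:R) ->
  u k ^+ n * phi (u k) @[k --> \oo] --> 0.
Proof.
move=> uE; apply: norm_cvg0.
pose C : R := n.+1`!%:R * expR 1 * normal_peak 1.
apply: (@squeeze_cvgr _ _ _ _ (cst 0) (fun k => C * harmonic k)).
- apply: nearW => k; rewrite normr_ge0/= /harmonic ler_pdivlMr ?ltr0n//.
  rewrite -uE -normrM mulrAC -exprSr.
  apply: le_trans (norm_exprM_pdf_le _ _) _; rewrite ler_piMr//.
    by rewrite !mulr_ge0 ?expR_ge0 ?normal_peak_ge0.
  by rewrite expR_le1 mulNr oppr_le0 divr_ge0 ?sqr_ge0.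
- exact: cvg_cst.
- by rewrite -[0](mulr0 C); apply: cvgM; [exact: cvg_cst|exact: cvg_harmonic].
Qed.

Definition gaussian_moment n : R := \int[mu]_x (x ^+ n * phi x).

Lemma continuous_exprM_pdf n : continuous (fun x : R => x ^+ n * phi x).
Proof.
move=> x; apply: cvgM; first exact: exprn_continuous.
by apply: continuous_normal_pdf; rewrite oner_eq0.
Qed.

Lemma gaussian_moment0 : gaussian_moment 0 = 1.
Proof.
rewrite /gaussian_moment /Rintegral; under eq_integral do rewrite expr0 mul1r.
by rewrite integral_normal_pdf.
Qed.

(** The integral over the line of the derivative of x^n phi(x), which is
    n x^(n-1) phi(x) - x^(n+1) phi(x), vanishes. For n = 0 the predecessor on
    the right is harmless because of the factor n. *)
Lemma gaussian_momentS n : gaussian_moment n.+1 = n%:R * gaussian_moment n.-1.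
Proof.
pose f (x : R) := n%:R * (x ^+ n.-1 * phi x) - x ^+ n.+1 * phi x.
have dF (x : R) : is_derive x 1 (fun x : R => x ^+ n * phi x) (f x).
  have dX := is_derive_exprn n (is_derive_id x (1 : R)).
  apply: (is_derive_eq (is_deriveM dX (is_derive_pdf x))).
  by rewrite /GRing.scale/= /f exprS; ring.
have cf : continuous f.
  move=> x; apply: cvgB; last exact: continuous_exprM_pdf.
  by apply: cvgM; [exact: cvg_cst|exact: continuous_exprM_pdf].
have i1 : mu.-integrable setT (EFin \o (fun x => n%:R * (x ^+ n.-1 * phi x))).
  exact: (integrableZl measurableT _ (integrable_exprM_pdf n.-1)).
have i2 := integrable_exprM_pdf n.+1.
have intf : mu.-integrable setT (EFin \o f) by exact: (integrableB measurableT i1 i2).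
have := integralT_is_derive_eq0 dF cf intf.
rewrite /f RintegralB// RintegralZl//; last exact: integrable_exprM_pdf.
move=> /(_ _ _)/eqP; rewrite subr_eq0 => e; apply/esym/eqP/e.
- by apply: cvg_exprM_pdf => k; rewrite ger0_norm.
- by apply: cvg_exprM_pdf => k; rewrite normrN ger0_norm.
Qed.

End gaussian_moments.

(** * Moments of the semicircle law *)

Section convolution.
Variables (F : numFieldType) (c : nat -> F).
Let S k := \sum_(j < k.+1) c j * c (k - j)%N.

(** Average the sum with its image under j -> k - j. *)
Let weighted_sum a k :
  2 * \sum_(j < k.+1) ((j + a)%:R * (c j * c (k - j)%N)) = (k + a.*2)%:R * S k.
Proof.
rewrite mulr_natl mulr2n {2}(reindex_inj rev_ord_inj) -big_split /S mulr_sumr.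
apply: eq_bigr => j _ /=.
have jk : (j <= k)%N by rewrite -ltnS.
rewrite subSS subKn// [c (k - j)%N * _]mulrC -mulrDl -natrD; congr (_%:R * _).
by rewrite -addnn addnACA subnKC.
Qed.

(** Let S k be the convolution sum. By symmetrization (k+6) S (k+2) is twice the
    sum of (j+2) c_j c_(k+2-j). In this sum the ratio hypothesis turns
    (j+2) c_j into 4 (j-1) c_(j-2) for j >= 2, which again is a weighted
    convolution sum, equal to 2 (k+2) S k. With S k = c (k+2) known by
    induction, this yields (k+6) S (k+2) = 4 (k+3) c (k+2) = (k+6) c (k+4).
    For c the even sequence of Catalan numbers this is Segner's recurrence. *)
Lemma convolution_of_ratio : c 0 = 1 -> c 1 = 0 ->
  (forall k, (k + 4)%:R * c k.+2 = 4 * k.+1%:R * c k) ->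
  forall k, c k.+2 = \sum_(j < k.+1) c j * c (k - j)%N.
Proof.
move=> c0 c1 crec k; rewrite -/(S k).
(* the induction goes by steps of two *)
suff : c k.+2 = S k /\ c k.+3 = S k.+1 by case.
elim: k => [|k [IHk IHk1]].
  split.
    apply: (@mulfI _ 4%:R); first by rewrite pnatr_eq0.
    by rewrite (crec 0%N) /S big_ord1 c0; ring.
  apply: (@mulfI _ 5%:R); first by rewrite pnatr_eq0.
  by rewrite (crec 1%N) /S 2!big_ord_recl big_ord0 c0 c1; ring.
split=> //; apply: (@mulfI _ (k.+2 + 4)%:R); first by rewrite pnatr_eq0.
rewrite crec -(weighted_sum 2) 2!big_ord_recl c1 /= c0 subn0 mul0r mulr0 add0r.
rewrite (eq_bigr (fun j : 'I_k.+1 => 4 * ((j + 1)%:R * (c j * c (k - j)%N)))).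
  rewrite -mulr_sumr; set X := \sum_(i < k.+1) _.
  have := weighted_sum 1 k; rewrite -/X -IHk => e.
  transitivity (4 * c k.+2 + 4 * (2 * X)); last by rewrite !natrD; ring.
  by rewrite e -[1.*2]/2%N -[k.+3]addn3 !natrD; ring.
move=> j _; rewrite /bump /= !add1n mulrA addSn addSn -addnS -addnS crec addn1.
by rewrite !subSS mulrA mulrA.
Qed.

End convolution.

Section semicircle.
Context (R : realType).
Notation mu := (@lebesgue_measure R).

Definition semicircle_moment (k : nat) : R := 1 / (2 * pi) *
  \int[mu]_(x in `[(-2 : R), 2]) (x ^+ k * Num.sqrt (4 - x ^+ 2)).

Let h : R := pi / 2.
Let I : set R := `[- h, h].
(** The substitution x = 2 sin u turns the moments of the semicircle law into
    integrals of smooth functions, with smooth antiderivatives up to the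
    boundary. *)
Let W k := \int[mu]_(x in I) (sin x ^+ k * cos x ^+ 2).

Let hN : - h < h.
Proof. by rewrite gtrN// /h divr_gt0// pi_gt0. Qed.

Let continuous_W k : continuous (fun x : R => sin x ^+ k * cos x ^+ 2).
Proof.
move=> x; apply: cvgM.
  apply: (@cvg_comp _ _ _ sin (fun y => y ^+ k)); first exact: continuous_sin.
  exact: exprn_continuous.
apply: (@cvg_comp _ _ _ cos (fun y => y ^+ 2)); first exact: continuous_cos.
exact: exprn_continuous.
Qed.

Let integrable_W k :
  mu.-integrable I (EFin \o (fun x : R => sin x ^+ k * cos x ^+ 2)).
Proof.
apply: continuous_compact_integrable; first exact: segment_compact.
exact/continuous_subspaceT/continuous_W.
Qed.

Let W0 : W 0 = pi / 2.
Proof.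
have dF (x : R) : is_derive x 1 (fun x : R => (x + sin x * cos x) / 2)
    (sin x ^+ 0 * cos x ^+ 2).
  apply: is_derive_eq; rewrite /GRing.scale/=; have := cos2Dsin2 x.
  by rewrite expr0; lra.
rewrite /W /Rintegral (integral_is_derive hN dF (@continuous_W 0)) /=.
by rewrite /h sinN cosN cos_pihalf; lra.
Qed.

Let W1 : W 1 = 0.
Proof.
have dF (x : R) : is_derive x 1 (fun x : R => - (cos x ^+ 3) / 3)
    (sin x ^+ 1 * cos x ^+ 2).
  by apply: is_derive_eq; rewrite /GRing.scale/=; field.
rewrite /W /Rintegral (integral_is_derive hN dF (@continuous_W 1)) /=.
by rewrite /h cosN cos_pihalf subrr.
Qed.

(** The difference of the two sides is the integral of the derivative of
    sin^(k+1) cos^3, and the cosine vanishes at both ends. *)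
Let WSS k : k.+1%:R * W k = (k + 4)%:R * W k.+2.
Proof.
pose f (x : R) := k.+1%:R * (sin x ^+ k * cos x ^+ 2) -
  (k + 4)%:R * (sin x ^+ k.+2 * cos x ^+ 2).
have dF (x : R) : is_derive x 1 (fun x : R => sin x ^+ k.+1 * cos x ^+ 3) (f x).
  have ds := is_derive_exprn k.+1 (is_derive_sin x).
  have dc := is_derive_exprn 3 (is_derive_cos x).
  apply: (is_derive_eq (is_deriveM ds dc)); rewrite /GRing.scale/= /f natrD.
  have -> : cos x ^+ 3 = cos x * (1 - sin x ^+ 2) by rewrite exprS cos2sin2.
  by rewrite !exprS; ring.
have cf : continuous f.
  by move=> x; apply: cvgB; apply: cvgM; by [exact: cvg_cst|exact: continuous_W].
have : \int[mu]_(x in I) f x = 0.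
  rewrite /Rintegral (integral_is_derive hN dF cf) /=.
  by rewrite /h cosN cos_pihalf expr0n !mulr0 subrr.
have iW c j : mu.-integrable I
    (EFin \o (fun x : R => c * (sin x ^+ j * cos x ^+ 2))).
  apply: continuous_compact_integrable; first exact: segment_compact.
  apply: continuous_subspaceT => x.
  by apply: cvgM; [exact: cvg_cst|exact: continuous_W].
have mI : measurable I by exact: measurable_itv.
rewrite /f RintegralB// !RintegralZl//.
by move/eqP; rewrite subr_eq0 => /eqP.
Qed.

Lemma semicircle_momentW k :
  semicircle_moment k = 1 / (2 * pi) * (2 ^+ k * 4 * W k).
Proof.
congr (_ * _).
have F2 : 2 * sin h = 2 :> R by rewrite sin_pihalf mulr1.
have F1 : 2 * sin (- h) = - 2 :> R by rewrite sinN sin_pihalf mulrN mulr1.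
have dF (x : R) : is_derive x 1 (fun y : R => 2 * sin y) (2 * cos x).
  by apply: is_derive_eq; rewrite /GRing.scale/=; ring.
have F'E : derive1 (fun y : R => 2 * sin y) = (fun x => 2 * cos x).
  by apply/funext => x; rewrite derive1E; have [_ ->] := dF x.
have c2 : continuous (fun x : R => 2 * cos x).
  by move=> x; apply: cvgM; [exact: cvg_cst|exact: continuous_cos].
have cF := continuous_is_derive dF.
pose G (x : R) := x ^+ k * Num.sqrt (4 - x ^+ 2).
have cG : continuous G.
  move=> x; apply: cvgM; first exact: exprn_continuous.
  apply: (@cvg_comp _ _ _ (fun y => 4 - y ^+ 2) Num.sqrt); last first.
    exact: sqrt_continuous.
  by apply: cvgB; [exact: cvg_cst|exact: exprn_continuous].
have := @integration_by_substitution_increasing R (fun x => 2 * sin x) G (- h) h.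
rewrite F1 F2 F'E /= => S.
rewrite /Rintegral [X in fine X]S; first last.
- exact: continuous_subspaceT.
- split.
  + by move=> x _; have [] := dF x.
  + exact/cvg_at_right_filter/cF.
  + exact/cvg_at_left_filter/cF.
- by apply/cvg_ex; exists (2 * cos h); exact/cvg_at_left_filter/c2.
- by apply/cvg_ex; exists (2 * cos (- h)); exact/cvg_at_right_filter/c2.
- by move=> x _; exact: c2.
- by move=> x y xI yI xy; rewrite ltr_pM2l// ltr_sin.
- exact: ltW.
have mI : measurable I by exact: measurable_itv.
rewrite -/(Rintegral _ _ _) /W -RintegralZl//.
apply: eq_Rintegral => x /[!inE] xI.
have c0 : 0 <= cos x by apply: cos_ge0_pihalf; move: xI; rewrite /= in_itv.
rewrite /= /G (_ : 4 - _ = (2 * cos x) ^+ 2); last first.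
  by rewrite !exprMn cos2sin2; ring.
by rewrite sqrtr_sqr ger0_norm ?mulr_ge0// exprMn; ring.
Qed.

Lemma semicircle_moment_conv k :
  [/\ semicircle_moment 0 = 1, semicircle_moment 1 = 0 &
   semicircle_moment k.+2 =
   \sum_(j < k.+1) semicircle_moment j * semicircle_moment (k - j)%N].
Proof.
have pi0 : pi != 0 :> R by rewrite gt_eqF// pi_gt0.
have c0 : semicircle_moment 0 = 1.
  by rewrite semicircle_momentW W0 expr0; move: pi pi0 => p p0; field.
have c1 : semicircle_moment 1 = 0 by rewrite semicircle_momentW W1 !mulr0.
split=> //; apply: convolution_of_ratio => // j.
rewrite !semicircle_momentW mulrCA [in RHS]mulrCA; congr (_ * _).
by rewrite !exprS mulrCA -WSS; ring.
Qed.

End semicircle.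

(** * Integration against the image of a weighted measure *)

Section change_of_variables.
Import HBNNSimple.
Local Open Scope ereal_scope.
Context d (T : measurableType d) d' (U : measurableType d') (R : realType).
Variables (mu : {measure set T -> \bar R}) (nu : {measure set U -> \bar R}).
Variables (X : T -> U) (g : T -> R).
Hypotheses (mX : measurable_fun setT X).
Hypotheses (mg : measurable_fun setT g) (g0 : forall x, (0 <= g x)%R).
Hypothesis nuE : forall B, measurable B ->
  nu B = \int[mu]_x (\1_B (X x) * g x)%:E.

(** The hypothesis is the case of indicators. It extends to simple functions by
    linearity and to nonnegative functions by monotone convergence. With X the
    identity this is integration against a density; in the proof that
    independent variables have product expectations, g is the product of all
    factors but one. *)
Lemma ge0_integral_weighted_image (f : U -> \bar R) :
  measurable_fun setT f -> (forall x, 0 <= f x) ->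
  \int[nu]_y f y = \int[mu]_x (f (X x) * (g x)%:E).
Proof.
move=> mf f0; pose h := nnsfun_approx measurableT mf.
have cvgh y : (h n y)%:E @[n --> \oo] --> f y.
  by apply: cvg_nnsfun_approx.
transitivity (limn (fun n => \int[nu]_y (h n y)%:E)).
  rewrite -monotone_convergence//.
  - by apply: eq_integral => y _; apply/esym/cvg_lim => //; exact: cvgh.
  - by move=> n; exact/measurable_EFinP/measurable_funP.
  - by move=> n y _; rewrite lee_fin.
  - by move=> y _ m n mn; rewrite lee_fin; exact/lefP/nd_nnsfun_approx.
transitivity (limn (fun n => \int[mu]_x (h n (X x) * g x)%:E)); last first.
  rewrite -monotone_convergence//.
  - apply: eq_integral => x _; apply/cvg_lim => //.
    by under eq_fun do rewrite EFinM; apply: cvgeZr => //; exact: cvgh.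
  - move=> n; apply/measurable_EFinP/measurable_funM => //.
    exact: measurableT_comp.
  - by move=> n y _; rewrite lee_fin mulr_ge0.
  - move=> y _ m n mn; rewrite lee_fin ler_wpM2r//.
    exact/lefP/nd_nnsfun_approx.
congr (limn _); apply/funext => n.
under eq_integral do rewrite fimfunE -fsumEFin//.
rewrite ge0_integral_fsum//; last 2 first.
- by move=> y; exact/measurable_EFinP/measurable_funM.
- by move=> y x _; rewrite nnfun_muleindic_ge0.
transitivity (\int[mu]_x \sum_(k \in range (h n))
    (k * \1_(h n @^-1` [set k]) (X x) * g x)%:E); last first.
  apply: eq_integral => x _; rewrite fsumEFin//; congr EFin.
  by rewrite -mulr_fsuml -fimfunE.
rewrite ge0_integral_fsum//; last 2 first.
- move=> y; apply/measurable_EFinP/measurable_funM => //.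
  by apply: measurable_funM => //; exact: measurableT_comp.
- by move=> y x _; rewrite EFinM mule_ge0 ?lee_fin// -lee_fin nnfun_muleindic_ge0.
apply: eq_fsbigr => r /[!inE] -[y _ <-].
under eq_integral do rewrite EFinM.
under [RHS]eq_integral do rewrite -mulrA EFinM.
have mB : measurable (h n @^-1` [set h n y]) by [].
rewrite !ge0_integralZl//.
- by rewrite integral_indic// setIT nuE.
- apply/measurable_EFinP/measurable_funM => //.
  by apply: measurableT_comp => //; exact: measurable_indic.
- by move=> x _; rewrite lee_fin mulr_ge0.
- by rewrite lee_fin.
- by apply/measurable_EFinP; exact: measurable_indic.
- by rewrite lee_fin.
Qed.

Lemma integrable_weighted_image (f : U -> R) : measurable_fun setT f ->
  mu.-integrable setT (fun x => (f (X x) * g x)%:E) ->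
  nu.-integrable setT (EFin \o f).
Proof.
move=> mf /integrableP[mfg ifg]; apply/integrableP; split.
  exact/measurable_EFinP.
rewrite ge0_integral_weighted_image//; last first.
  by apply: measurableT_comp => //; exact/measurable_EFinP.
apply: le_lt_trans ifg; rewrite le_eqVlt; apply/orP; left; apply/eqP.
by apply: eq_integral => x _ /=; rewrite normrM (ger0_norm (g0 x)) EFinM.
Qed.

Lemma integral_weighted_image (f : U -> R) : measurable_fun setT f ->
  \int[nu]_y (f y)%:E = \int[mu]_x (f (X x) * g x)%:E.
Proof.
move=> mf; rewrite [LHS]integralE [RHS]integralE.
have mfE : measurable_fun setT (EFin \o f) by exact/measurable_EFinP.
rewrite !ge0_integral_weighted_image//; last 2 first.
- exact: measurable_funeneg.
- exact: measurable_funepos.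
congr (_ - _); apply: eq_integral => x _.
  by rewrite !funeposE /= -!EFin_max -EFinM maxr_pMl// mul0r.
by rewrite !funenegE /= -!EFin_max -EFinM maxr_pMl// mul0r mulNr.
Qed.

End change_of_variables.

(** * Expectation of a product of independent variables *)

Section independence.
Context d (T : measurableType d) (R : realType) (P : probability T R).
Context d' (U : measurableType d') (K : finType).
Variable (X : K -> {RV P >-> U}).
Hypothesis indepX : forall B : K -> set U, (forall k, measurable (B k)) ->
  P (\bigcap_k X k @^-1` B k) = (\prod_k P (X k @^-1` B k))%E.

Definition factorizes (f : K -> U -> R) :=
  P.-integrable setT (fun t => (\prod_k f k (X k t))%:E) /\
  \int[P]_t (\prod_k f k (X k t)) = \prod_k \int[P]_t f k (X k t).

Lemma factorizes_indic (B : K -> set U) : (forall k, measurable (B k)) ->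
  factorizes (fun k => \1_(B k)).
Proof.
move=> mB.
have mXB k : measurable (X k @^-1` B k).
  by rewrite -[_ @^-1` _]setTI; exact: measurable_funP.
have mbig : measurable (\bigcap_k X k @^-1` B k).
  by apply: (@fin_bigcap_measurable _ T K) => //; exact: finite_finset.
have E t : \prod_k (\1_(B k) (X k t) : R) = \1_(\bigcap_k X k @^-1` B k) t.
  rewrite [RHS]indicE; have [tB|tB] := pselect ((\bigcap_k X k @^-1` B k) t).
    rewrite (mem_set tB) big1// => k _; rewrite indicE mem_set//; exact: tB.
  rewrite (memNset tB).
  have [k tBk] : exists k, ~ B k (X k t).
    by apply: contra_notP tB => /forallNP tB k _; apply: contrapT; exact: tB.
  by rewrite (bigD1 k)//= indicE memNset// mul0r.
split; first by under eq_fun do rewrite E; exact: integrable_indic.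
under eq_Rintegral do rewrite E.
rewrite /Rintegral integral_indic// setIT.
transitivity (fine (\prod_k P (X k @^-1` B k))%E); first by rewrite -indepX.
apply: EFin_inj; rewrite fineK; last first.
  by apply: prode_fin_num => k _; exact: fin_num_measure.
rewrite -prodEFin; apply: eq_bigr => k _.
have -> : (\int[P]_t (\1_(B k) (X k t) : R)%:E = \int[P]_t (\1_(X k @^-1` B k) t)%:E)%E by [].
by rewrite integral_indic// setIT fineK// fin_num_measure.
Qed.

(** One factor is generalized at a time, the others being kept fixed. *)
Let upd (f : K -> U -> R) a h := fun k => if k == a then h else f k.

Let upd_id f a : upd f a (f a) = f.
Proof. by apply/funext => k; rewrite /upd; case: eqP => // ->. Qed.

Let prod_upd f a h t : \prod_k upd f a h k (X k t) =
  h (X a t) * \prod_(k | k != a) f k (X k t).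
Proof.
rewrite (bigD1 a)//= {1}/upd eqxx; congr (_ * _).
by apply: eq_bigr => k ka; rewrite /upd (negbTE ka).
Qed.

Let int_upd f a h : \prod_k \int[P]_t upd f a h k (X k t) =
  (\int[P]_t h (X a t)) * \prod_(k | k != a) \int[P]_t f k (X k t).
Proof.
rewrite (bigD1 a)//= {1}/upd eqxx; congr (_ * _).
by apply: eq_bigr => k ka; rewrite /upd (negbTE ka).
Qed.

(** For fixed other factors, both sides are integrals of h(X_a) against measures
    that agree on indicators: the image under X_a of P weighted by the product g
    of the other factors, and a multiple of the law of X_a. *)
Lemma factorizes_upd_ge0 (f : K -> U -> R) a (h : U -> R) :
  (forall k, measurable_fun setT (f k)) -> (forall k x, 0 <= f k x) ->
  (forall B, measurable B -> factorizes (upd f a \1_B)) ->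
  measurable_fun setT h -> (forall x, 0 <= h x) ->
  P.-integrable setT (fun t => (h (X a t))%:E) ->
  factorizes (upd f a h).
Proof.
move=> mf f0 indf mh h0 ih.
pose g t := \prod_(k | k != a) f k (X k t).
pose c := \prod_(k | k != a) \int[P]_t f k (X k t).
have c0 : 0 <= c.
  by apply: prodr_ge0 => k _; apply: Rintegral_ge0.
have mg : measurable_fun setT g.
  rewrite /g; under eq_fun do rewrite -big_filter.
  by apply: measurable_prod => k _; exact: measurableT_comp.
have g0 t : 0 <= g t by apply: prodr_ge0.
pose nu := mscale (NngNum c0) (distribution P (X a)).
have nuE B : measurable B -> nu B = (\int[P]_t (\1_B (X a t) * g t)%:E)%E.
  move=> mB; have [] := indf B mB; under eq_fun do rewrite prod_upd.
  move=> i; under eq_Rintegral do rewrite prod_upd; rewrite int_upd => e.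
  rewrite /nu /mscale/= -[RHS]fineK; last exact: integrable_fin_num.
  rewrite [fine _]e /distribution /pushforward EFinM muleC; congr (_ * _)%E.
  have mXB : measurable (X a @^-1` B).
    by rewrite -[_ @^-1` _]setTI; exact: measurable_funP.
  have E : (\int[P]_t (\1_B (X a t) : R)%:E = \int[P]_t (\1_(X a @^-1` B) t)%:E)%E by [].
  by rewrite /Rintegral E integral_indic// setIT fineK// fin_num_measure.
have hg : (\int[P]_t (h (X a t) * g t)%:E =
    ((\int[P]_t h (X a t)) * c)%:E)%E.
  rewrite -(integral_weighted_image (measurable_funPT (X a)) mg g0 nuE mh).
  rewrite ge0_integral_mscale//; first last.
  - by move=> x _; rewrite lee_fin.
  - exact/measurable_EFinP.
  rewrite ge0_integral_distribution//; last exact/measurable_EFinP.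
  by rewrite EFinM muleC /Rintegral fineK// integrable_fin_num.
split.
  under eq_fun do rewrite prod_upd.
  apply/integrableP; split.
    apply/measurable_EFinP/measurable_funM => //.
    exact: measurableT_comp.
  rewrite (eq_integral (fun t => (h (X a t) * g t)%:E)); last first.
    by move=> t _; rewrite /= ger0_norm// mulr_ge0//; exact: g0.
  by rewrite hg ltry.
under eq_Rintegral do rewrite prod_upd.
by rewrite int_upd /Rintegral hg.
Qed.

(** Induction on the list of indices whose factor is not an indicator. *)
Lemma factorizes_ge0 (f : K -> U -> R) :
  (forall k, measurable_fun setT (f k)) -> (forall k x, 0 <= f k x) ->
  (forall k, P.-integrable setT (fun t => (f k (X k t))%:E)) ->
  factorizes f.
Proof.
move=> mf f0 intf.
have : forall k, k \notin enum K -> exists2 B, measurable B & f k = \1_B.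
  by move=> k; rewrite mem_enum.
elim: (enum K) f mf f0 intf => [|a s IHs] f mf f0 intf fB.
  have /choice[B BP] : forall k, exists B, d'.-measurable B /\ f k = \1_B.
    by move=> k; have [B] := fB k isT; exists B.
  have -> : f = fun k => \1_(B k) by apply/funext => k; case: (BP k).
  by apply: factorizes_indic => k; case: (BP k).
rewrite -(upd_id f a); apply: factorizes_upd_ge0 => // B mB; apply: IHs.
- by move=> k; rewrite /upd; case: eqP.
- by move=> k x; rewrite /upd; case: eqP.
- move=> k; rewrite /upd; case: eqP => // _.
  have mXB : measurable (X k @^-1` B).
    by rewrite -[_ @^-1` _]setTI; exact: measurable_funP.
  exact: (integrable_indic P mXB).
- move=> k ks; rewrite /upd; case: eqP => [_|ka]; first by exists B.
  by apply: fB; rewrite inE negb_or ks andbT; apply/eqP.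
Qed.

Lemma factorizes_updB (f : K -> U -> R) a (h1 h2 : U -> R) :
  P.-integrable setT (fun t => (h1 (X a t))%:E) ->
  P.-integrable setT (fun t => (h2 (X a t))%:E) ->
  factorizes (upd f a h1) -> factorizes (upd f a h2) ->
  factorizes (upd f a (fun x => h1 x - h2 x)).
Proof.
move=> ih1 ih2 [i1 e1] [i2 e2]; split.
  apply: eq_integrable (integrableB measurableT i1 i2) => // t _ /=.
  by rewrite !prod_upd mulrBl EFinB.
under eq_Rintegral do rewrite prod_upd mulrBl -!prod_upd.
rewrite RintegralB// [LHS](congr2 (fun x y => x - y) e1 e2) !int_upd.
by rewrite -mulrBl -RintegralB.
Qed.

(** Induction on the list of indices whose factor may change sign: such a factor
    is the difference of its positive and negative parts. *)
Theorem integral_prod_independent (f : K -> U -> R) :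
  (forall k, measurable_fun setT (f k)) ->
  (forall k, P.-integrable setT (fun t => (f k (X k t))%:E)) ->
  P.-integrable setT (fun t => (\prod_k f k (X k t))%:E) /\
  \int[P]_t (\prod_k f k (X k t)) = \prod_k \int[P]_t f k (X k t).
Proof.
move=> mf intf; rewrite -/(factorizes f).
have : forall k x, k \notin enum K -> 0 <= f k x.
  by move=> k x; rewrite mem_enum.
elim: (enum K) f mf intf => [|a s IHs] f mf intf f0.
  by apply: factorizes_ge0 => // k x; exact: f0.
have fE : f a = fun x => (f a)^\+ x - (f a)^\- x.
  by apply/funext => x; rewrite -{1}(funrposBneg (f a)).
have ip := integrable_funrpos measurableT (intf a).
have im := integrable_funrneg measurableT (intf a).
have IH h : measurable_fun setT h ->
    P.-integrable setT (fun t => (h (X a t))%:E) -> (forall x, 0 <= h x) ->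
    factorizes (upd f a h).
  move=> mh ih h0; apply: IHs => [k|k|k x ks]; rewrite /upd.
  - by case: eqP.
  - by case: eqP => // ->.
  - by case: eqP => // /eqP ka; apply: f0; rewrite inE negb_or ka.
rewrite -(upd_id f a) fE; apply: factorizes_updB => //; apply: IH => //.
- exact: measurable_funrpos.
- exact: measurable_funrneg.
Qed.

End independence.

(** * Gaussian integration by parts *)

Section standard_gaussian_moments.
Context d (T : measurableType d) (R : realType) (P : probability T R).

Lemma standard_gaussian_moment (X : {RV P >-> R}) n : standard_gaussian X ->
  P.-integrable setT (fun t => (X t ^+ n)%:E) /\
  \int[P]_t (X t ^+ n) = gaussian_moment R n.
Proof.
move=> gX.
have nuE B : measurable B -> distribution P X B =
    (\int[lebesgue_measure]_x (\1_B x * normal_pdf 0 1 x)%:E)%E.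
  move=> mB; rewrite gX// /normal_prob integral_mkcond; apply: eq_integral => x _.
  by rewrite patchE indicE; case: ifP; rewrite ?mul1r ?mul0r.
have mX : measurable_fun setT (fun x : R => x ^+ n) by exact: exprn_measurable.
have mid : measurable_fun setT (@id R) by exact: measurable_id.
have mp := @measurable_normal_pdf R 0 1.
have inu := @integrable_weighted_image _ _ _ _ R (@lebesgue_measure R)
  (distribution P X) _ _ mid mp (@normal_pdf_ge0 R 0 1) nuE _ mX
  (integrable_exprM_pdf R n).
have eqnu := @integral_weighted_image _ _ _ _ R (@lebesgue_measure R)
  (distribution P X) _ _ mid mp (@normal_pdf_ge0 R 0 1) nuE _ mX.
have iX : P.-integrable setT (fun t => (X t ^+ n)%:E).
  apply/integrableP; split.
    apply/measurable_EFinP.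
    exact: (measurableT_comp mX (measurable_funPT X)).
  move/integrableP : inu => [_].
  rewrite ge0_integral_distribution//.
  by apply: measurableT_comp => //; exact/measurable_EFinP.
split=> //; rewrite /Rintegral /gaussian_moment /Rintegral -eqnu.
rewrite integral_distribution//; exact/measurable_EFinP.
Qed.

End standard_gaussian_moments.

Section complex_expectation.
Context d (T : measurableType d) (R : realType) (P : probability T R).
Implicit Types Z W : T -> R[i].

Lemma complex_expectationE Z : complex_expectation P Z =
  (\int[P]_t complex.Re (Z t)) +i* (\int[P]_t complex.Im (Z t)).
Proof. by rewrite /complex_expectation unlock. Qed.

Lemma complex_expectationD Z W :
  complex_integrable P Z -> complex_integrable P W ->
  complex_integrable P (fun t => Z t + W t) /\
  complex_expectation P (fun t => Z t + W t) =
    complex_expectation P Z + complex_expectation P W.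
Proof.
move=> [rZ iZ] [rW iW].
have reE t : complex.Re (Z t + W t) = complex.Re (Z t) + complex.Re (W t).
  by case: (Z t) (W t) => [a b] [a' b'].
have imE t : complex.Im (Z t + W t) = complex.Im (Z t) + complex.Im (W t).
  by case: (Z t) (W t) => [a b] [a' b'].
split.
  split; [under eq_fun do rewrite reE|under eq_fun do rewrite imE].
    exact: (integrableD measurableT rZ rW).
  exact: (integrableD measurableT iZ iW).
rewrite !complex_expectationE.
under eq_Rintegral do rewrite reE.
under [X in _ +i* X]eq_Rintegral do rewrite imE.
by rewrite !RintegralD.
Qed.

Lemma complex_expectationZ (c : R[i]) Z : complex_integrable P Z ->
  complex_integrable P (fun t => c * Z t) /\
  complex_expectation P (fun t => c * Z t) = c * complex_expectation P Z.
Proof.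
case: c => a b [rZ iZ].
have reE t : complex.Re ((a +i* b) * Z t) =
    a * complex.Re (Z t) - b * complex.Im (Z t).
  by case: (Z t) => x y.
have imE t : complex.Im ((a +i* b) * Z t) =
    a * complex.Im (Z t) + b * complex.Re (Z t).
  by case: (Z t) => x y.
have iM u (Y : T -> R) : P.-integrable setT (fun t => (Y t)%:E) ->
    P.-integrable setT (fun t => (u * Y t)%:E).
  by move=> iY; exact: (integrableZl measurableT u iY).
split.
  split; [under eq_fun do rewrite reE|under eq_fun do rewrite imE].
    exact: (integrableB measurableT (iM _ _ rZ) (iM _ _ iZ)).
  exact: (integrableD measurableT (iM _ _ iZ) (iM _ _ rZ)).
rewrite !complex_expectationE.
under eq_Rintegral do rewrite reE.
under [X in _ +i* X]eq_Rintegral do rewrite imE.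
by rewrite RintegralB ?RintegralD ?RintegralZl//; try exact: iM.
Qed.

Lemma complex_expectation_real (X : T -> R) :
  P.-integrable setT (fun t => (X t)%:E) ->
  complex_integrable P (fun t => (X t)%:C) /\
  complex_expectation P (fun t => (X t)%:C) = (\int[P]_t X t)%:C.
Proof.
move=> iX; split; first by split => //; exact: integrable0.
by rewrite complex_expectationE /= Rintegral_cst// mul0r.
Qed.

End complex_expectation.

Section gaussian_integration_by_parts.
Context d (T : measurableType d) (R : realType) (P : probability T R).
Variables (n : nat) (G : 'I_n -> {RV P >-> R}).
Hypothesis gaussG : forall k, standard_gaussian (G k).
Hypothesis indepG : forall B : 'I_n -> set R, (forall k, measurable (B k)) ->
  P (\bigcap_k G k @^-1` B k) = (\prod_k P (G k @^-1` B k))%E.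

Let ev (p : mpoly n R[i]) t := meval (fun k => (G k t)%:C) p.

Definition poly_expectation (p : mpoly n R[i]) : R[i] :=
  complex_expectation P (ev p).
Let Ex := poly_expectation.

Lemma poly_expectationX (m : multinom n) :
  complex_integrable P (ev (mpolyX _ m)) /\
  Ex (mpolyX _ m) = (\prod_k gaussian_moment R (m k))%:C.
Proof.
have evE : ev (mpolyX _ m) = fun t => (\prod_k (G k t ^+ m k))%:C.
  apply/funext => t; rewrite /ev mevalX rmorph_prod.
  by apply: eq_bigr => k _; rewrite rmorphXn.
have mX k : measurable_fun setT (fun x : R => x ^+ m k).
  exact: exprn_measurable.
have [] := integral_prod_independent indepG mX.
  by move=> k; have [] := standard_gaussian_moment (m k) (gaussG k).
move=> iG eG; have [iC eC] := complex_expectation_real iG.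
rewrite /Ex /poly_expectation evE; split=> //; rewrite eC eG; congr (_%:C).
by apply: eq_bigr => k _; have [] := standard_gaussian_moment (m k) (gaussG k).
Qed.

Lemma poly_integrable p : complex_integrable P (ev p).
Proof.
elim/mpolyind: p => [|c m p _ _ IHp].
  have [] := complex_expectationZ 0 (poly_expectationX (@mnm0 n)).1.
  have -> : (fun t => 0 * ev (mpolyX R[i] (@mnm0 n)) t) = ev 0.
    by apply/funext => t; rewrite mul0r /ev meval0.
  by [].
have [iX _] := complex_expectationZ c (poly_expectationX m).1.
have [] := complex_expectationD iX IHp.
have -> : (fun t => c * ev (mpolyX R[i] m) t + ev p t) =
    ev (c *: mpolyX _ m + p).
  by apply/funext => t; rewrite /ev mevalD mevalZ.
by [].
Qed.

Lemma poly_expectationZ c p : Ex (c *: p) = c * Ex p.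
Proof.
rewrite -(complex_expectationZ c (poly_integrable p)).2.
by congr complex_expectation; apply/funext => t; rewrite /ev mevalZ.
Qed.

Lemma poly_expectationD p q : Ex (p + q) = Ex p + Ex q.
Proof.
rewrite -(complex_expectationD (poly_integrable p) (poly_integrable q)).2.
by congr complex_expectation; apply/funext => t; rewrite /ev mevalD.
Qed.

(** By linearity p is a monomial of multidegree m. Both expectations are products
    of one-dimensional moments that differ only in the k-th factor, where the
    identity is [gaussian_momentS]. *)
Lemma gaussian_ibp k p : Ex (mpolyX _ (mnm1 k) * p) = Ex (mderiv k p).
Proof.
elim/mpolyind: p => [|c m p _ _ IHp]; first by rewrite mulr0 mderiv0.
rewrite mulrDr mderivD !poly_expectationD IHp; congr (_ + _).
rewrite -scalerAr mderivZ !poly_expectationZ; congr (_ * _).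
rewrite -mpolyXD mderivX poly_expectationZ !(poly_expectationX _).2.
rewrite (bigD1 k)//= [in RHS](bigD1 k)//= mnmDE mnmBE mnm1E eqxx add1n subn1.
have -> : (m k)%:R = ((m k)%:R : R)%:C by rewrite rmorph_nat.
rewrite gaussian_momentS -rmorphM mulrA.
congr ((_ * _)%:C); apply: eq_bigr => j jk.
by rewrite mnmDE mnmBE mnm1E eq_sym (negbTE jk) add0n subn0.
Qed.

End gaussian_integration_by_parts.

(** * Derivations and powers of matrices *)

Section derivation.
Variables (S : comNzRingType) (D : {additive S -> S}).
Hypothesis DM : forall p q, D (p * q) = D p * q + p * D q.

Lemma derivation1 : D 1 = 0.
Proof. by apply: (@addrI _ (D 1)); rewrite addr0 -{3}[1]mulr1 DM mulr1 mul1r. Qed.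

Lemma derivation_prod (T : Type) (s : seq T) (x0 : T) (f : T -> S) :
  D (\prod_(r <- s) f r) =
  \sum_(i < size s) D (f (nth x0 s i)) * \prod_(r <- take i s ++ drop i.+1 s) f r.
Proof.
elim: s => [|a s IHs]; first by rewrite big_nil derivation1 big_ord0.
rewrite big_cons DM IHs big_ord_recl /= drop0; congr (_ + _).
rewrite mulr_sumr; apply: eq_bigr => i _ /=.
by rewrite big_cons mulrCA.
Qed.

Lemma derivation_mulmx m n p (A : 'M[S]_(m, n)) (B : 'M[S]_(n, p)) :
  map_mx D (A *m B) = map_mx D A *m B + A *m map_mx D B.
Proof.
apply/matrixP => i j; rewrite !mxE raddf_sum -big_split /=.
by apply: eq_bigr => k _; rewrite DM !mxE.
Qed.

Lemma derivation_expmx n (A : 'M[S]_n) k :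
  map_mx D (A ^+ k) = \sum_(l < k) A ^+ l *m map_mx D A *m A ^+ (k.-1 - l).
Proof.
elim: k => [|k IHk].
  rewrite big_ord0; apply/matrixP => i j; rewrite !mxE.
  by case: eqP => _; rewrite ?derivation1 ?raddf0.
rewrite exprS -mulmxE derivation_mulmx IHk big_ord_recl /= expr0 mul1mx subn0.
congr (_ + _); rewrite mulmx_sumr; apply: eq_bigr => i _ /=.
rewrite /bump /= add1n exprS -!mulmxE !mulmxA.
by congr (_ *m _ ^+ _); case: k i {IHk} => [[]//|k i] /=; rewrite subSS.
Qed.

Lemma derivation_trace n (A : 'M[S]_n) : D (\tr A) = \tr (map_mx D A).
Proof. by rewrite raddf_sum; apply: eq_bigr => i _; rewrite mxE. Qed.

End derivation.

Lemma mulmx_deltaE (S : comNzRingType) n (A B : 'M[S]_n) (i j k l : 'I_n) :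
  (A *m delta_mx j i *m B) k l = A k j * B i l.
Proof.
rewrite mxE (bigD1 i) //= big1 ?addr0.
  rewrite mxE (bigD1 j) //= big1 ?addr0 ?mxE ?eqxx ?mulr1 //.
  by move=> h hj; rewrite mxE (negbTE hj) mulr0.
move=> h hi; rewrite mxE big1 ?mul0r // => h' _.
by rewrite mxE (negbTE hi) andbF mulr0.
Qed.

(** * The loop equation *)

Section loop_equation.
Variables (C : comNzRingType) (S : comAlgType C) (n : nat) (M : 'M[S]_n).
Variables (Ex : S -> C) (D : 'I_n -> 'I_n -> {additive S -> S}) (c : C).
Hypothesis DM : forall i j p q, D i j (p * q) = D i j p * q + p * D i j q.
Hypothesis DMx : forall i j, map_mx (D i j) M = c%:A *: delta_mx j i.
Hypothesis ExD : forall p q, Ex (p + q) = Ex p + Ex q.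
Hypothesis ExZ : forall a p, Ex (a *: p) = a * Ex p.
Hypothesis ibp : forall i j p, Ex (M i j * p) = Ex (D i j p).

Let Ex_sum I (r : seq I) (Q : pred I) (F : I -> S) :
  Ex (\sum_(i <- r | Q i) F i) = \sum_(i <- r | Q i) Ex (F i).
Proof.
by apply: (big_morph Ex ExD); rewrite -(scale0r (0 : S)) ExZ mul0r.
Qed.

Let ExMn p k : Ex (p *+ k) = Ex p *+ k.
Proof. by rewrite -scaler_nat ExZ mulr_natl. Qed.

(** When the derivation hits one factor M, the matrix unit E_ji that it leaves
    splits the power of M into a product of two diagonal entries. *)
Lemma derivation_expM i j k :
  D i j ((M ^+ k) j i) =
  c *: \sum_(l < k) (M ^+ l) j j * (M ^+ (k.-1 - l)) i i.
Proof.
have -> : D i j ((M ^+ k) j i) = (map_mx (D i j) (M ^+ k)) j i by rewrite mxE.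
rewrite (derivation_expmx (@DM i j)) summxE scaler_sumr; apply: eq_bigr => l _.
by rewrite DMx -scalemxAr -scalemxAl mxE mulmx_deltaE -scalerAl mul1r.
Qed.

(** All k terms of the Leibniz rule are equal by cyclicity of the trace. *)
Lemma derivation_trM i j k :
  D i j (\tr (M ^+ k)) = c *: ((M ^+ k.-1) i j *+ k).
Proof.
rewrite (derivation_trace _ (M ^+ k)) (derivation_expmx (@DM i j)) raddf_sum /=.
rewrite (eq_bigr (fun=> c *: (M ^+ k.-1) i j)); last first.
  move=> l _; rewrite DMx -scalemxAr -scalemxAl linearZ /=.
  rewrite mxtrace_mulC mulmxA mulmxE -exprD subnK; last first.
    by case: k l => [[]|k l] //=; rewrite -ltnS.
  rewrite mulr_algl; congr (_ *: _).
  rewrite /mxtrace (eq_bigr (fun h => (M ^+ k.-1) h j * (1%:M : 'M[S]_n) i h)).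
    rewrite (bigD1 i) //= mxE eqxx mulr1 big1 ?addr0 // => h hi.
    by rewrite mxE eq_sym (negbTE hi) mulr0.
  by move=> h _; rewrite -mulmx_deltaE mulmx1.
by rewrite sumr_const card_ord scalerMnr.
Qed.

Lemma mxtrace_mulE (A B : 'M[S]_n) : \tr (A *m B) = \sum_i \sum_j A i j * B j i.
Proof. by apply: eq_bigr => i _; rewrite mxE. Qed.

(** Expand the first trace as the sum over i, j of M_ij (M^k)_ji and integrate by
    parts. The derivation of (M^k)_ji gives, after summation, products of two
    traces; the derivation of the trace of a power s_i gives entries of M^(s_i - 1),
    which recombine with those of M^k into one trace. An exponent s_i = 0 has
    weight 0, so that the truncation of its predecessor does not matter. *)
Lemma loop_equation k (s : seq nat) :
  Ex (\tr (M ^+ k.+1) * \prod_(r <- s) \tr (M ^+ r)) =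
  c * (\sum_(l < k)
         Ex (\prod_(r <- [:: val l, (k.-1 - l)%N & s]) \tr (M ^+ r)) +
       \sum_(i < size s)
         Ex (\prod_(r <- (k + (nth 0 s i).-1)%N :: take i s ++ drop i.+1 s)
              \tr (M ^+ r)) *+ nth 0%N s i).
Proof.
set Q := \prod_(r <- s) _.
rewrite exprS -mulmxE mxtrace_mulE mulr_suml Ex_sum /=.
under eq_bigr => i _ do rewrite mulr_suml Ex_sum /=.
under eq_bigr => i _ do under eq_bigr => j _ do
  rewrite -mulrA ibp DM ExD derivation_expM /=.
(* the contribution of the power and that of the other traces *)
pose f i j := Ex (\sum_(l < k) (M ^+ l) j j * (M ^+ (k.-1 - l)) i i * Q).
pose g i j := Ex (\sum_(h < size s) (M ^+ k) j i * (M ^+ (nth 0 s h).-1) i j *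
  \prod_(r <- take h s ++ drop h.+1 s) \tr (M ^+ r) *+ nth 0 s h).
transitivity (\sum_i \sum_j (c * f i j + c * g i j)).
  apply: eq_bigr => i _; apply: eq_bigr => j _.
  rewrite -!ExZ; congr (Ex _ + Ex _).
    by rewrite -scalerAl mulr_suml.
  rewrite (derivation_prod (@DM i j) s 0%N) mulr_sumr scaler_sumr.
  apply: eq_bigr => h _; rewrite derivation_trM -scalerAl -scalerAr.
  by rewrite mulrnAl mulrnAr mulrA.
transitivity (\sum_i (\sum_j c * f i j + \sum_j c * g i j)).
  by apply: eq_bigr => i _; rewrite big_split.
rewrite big_split /=.
under eq_bigr do rewrite -mulr_sumr -Ex_sum.
under [X in _ + X]eq_bigr do rewrite -mulr_sumr -Ex_sum.
rewrite -!mulr_sumr -!Ex_sum -mulrDr; congr (_ * (_ + _)).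
  congr (Ex _).
  under eq_bigr => i _ do rewrite exchange_big.
  rewrite exchange_big /=; apply: eq_bigr => l _.
  rewrite !big_cons exchange_big mulrA /mxtrace mulr_suml mulr_suml.
  apply: eq_bigr => j _; rewrite mulr_sumr mulr_suml.
  by apply: eq_bigr => i _.
under [in RHS]eq_bigr => i _ do rewrite -ExMn.
rewrite -Ex_sum; congr (Ex _).
under eq_bigr => i _ do rewrite exchange_big.
rewrite exchange_big /=; apply: eq_bigr => h _.
rewrite big_cons exprD -mulmxE mxtrace_mulE mulr_suml -sumrMnl exchange_big /=.
apply: eq_bigr => j _; rewrite mulr_suml -sumrMnl.
by apply: eq_bigr => i _.
Qed.

End loop_equation.

(** * The real Gaussian coordinates of a GUE matrix *)

Section gue_gaussians.
Context d (T : measurableType d) (R : realType) (P : probability T R).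
Variables (N : nat) (a : 'I_N -> 'I_N -> T -> R[i]).
Hypothesis a_indep : independent_family P
  [set ij : 'I_N * 'I_N | (ij.2 <= ij.1)%N] (fun ij t => reim (a ij.1 ij.2 t)).
Hypothesis a_offdiag : forall i j, i != j -> standard_complex_gaussian P (a i j).
Hypothesis a_diag : forall i, standard_real_gaussian P (a i i).

Definition entry_gaussians (e : 'I_N * 'I_N) (XY : {RV P >-> R} * {RV P >-> R}) :=
  [/\ standard_gaussian XY.1, standard_gaussian XY.2 &
   if e.1 == e.2 then forall t, a e.1 e.2 t = (XY.1 t)%:C
   else independent_pair P XY.1 XY.2 /\
        forall t, a e.1 e.2 t = (XY.1 t +i* XY.2 t) / (Num.sqrt 2)%:C].

Let entry_gaussiansP e : exists XY, entry_gaussians e XY.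
Proof.
case: e => i j; have [<-|ij] := eqVneq i j.
  have [X [gX aX]] := a_diag i; exists (X, X).
  by rewrite /entry_gaussians /= eqxx.
have [X [Y [gX gY XY aXY]]] := a_offdiag ij; exists (X, Y).
by rewrite /entry_gaussians /= (negbTE ij).
Qed.

Let f := projT1 (choice entry_gaussiansP).
Let fP e : entry_gaussians e (f e).
Proof. exact: (projT2 (choice entry_gaussiansP)). Qed.

(** One real Gaussian for each pair of indices: the scaled real part of the entry
    a i j sits at (i, j) and its imaginary part at (j, i), for j < i. The
    diagonal entries are real and sit at (i, i). *)
Definition gue_gaussian (e : 'I_N * 'I_N) : {RV P >-> R} :=
  if (e.2 <= e.1)%N then (f e).1 else (f (e.2, e.1)).2.
Local Notation G := gue_gaussian.

Lemma gue_gaussian_standard e : standard_gaussian (G e).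
Proof. by rewrite /G; case: ifP => _; [case: (fP e)|case: (fP (e.2, e.1))]. Qed.

Lemma gue_diagE i t : a i i t = (G (i, i) t)%:C.
Proof. by rewrite /G /= leqnn; have [_ _ /=] := fP (i, i); rewrite eqxx. Qed.

Lemma gue_offdiagE (i j : 'I_N) t : (j < i)%N ->
  a i j t = (G (i, j) t +i* G (j, i) t) / (Num.sqrt 2)%:C.
Proof.
move=> ji; rewrite /G /= (ltnW ji) leqNgt ji /=.
by have [_ _ /=] := fP (i, j); case: eqP => [ij|_ []//]; rewrite ij ltnn in ji.
Qed.

Lemma gue_gaussian_pair (i j : 'I_N) : (j < i)%N ->
  independent_pair P (G (i, j)) (G (j, i)).
Proof.
move=> ji; rewrite /G /= (ltnW ji) leqNgt ji /=.
by have [_ _ /=] := fP (i, j); case: eqP => [ij|_ []//]; rewrite ij ltnn in ji.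
Qed.

Lemma div_sqrt2E (x y : R) :
  (x +i* y) / (Num.sqrt 2)%:C = (x / Num.sqrt 2) +i* (y / Num.sqrt 2).
Proof.
rewrite -fmorphV /=; apply/eqP; rewrite eq_complex /=.
by apply/andP; split; apply/eqP; ring.
Qed.

(** The events on the N^2 coordinates are grouped into one event for each entry
    on or below the diagonal. The entries are independent, and inside an
    off-diagonal entry the real and imaginary parts are. *)
Lemma gue_gaussian_indep (B : 'I_N * 'I_N -> set R) :
  (forall e, measurable (B e)) ->
  P (\bigcap_e G e @^-1` B e) = (\prod_e P (G e @^-1` B e))%E.
Proof.
move=> mB.
have s2 : Num.sqrt 2 != 0 :> R by rewrite gt_eqF// sqrtr_gt0.
pose C (e : 'I_N * 'I_N) : set (R * R) :=
  if e.1 == e.2 then fst @^-1` B e else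
  (fun z => z.1 * Num.sqrt 2) @^-1` B e `&`
  (fun z => z.2 * Num.sqrt 2) @^-1` B (e.2, e.1).
have mC e : measurable (C e).
  rewrite /C; case: ifP => _.
    have mf : measurable_fun setT (@fst R R) by exact: measurable_fst.
    by rewrite -[X in measurable X]setTI; exact: (mf measurableT _ (mB _)).
  apply: measurableI; rewrite -[X in measurable X]setTI.
    have mf : measurable_fun setT (fun z : R * R => z.1 * Num.sqrt 2).
      by apply: measurable_funM => //; exact: measurable_fst.
    exact: (mf measurableT _ (mB _)).
  have mf : measurable_fun setT (fun z : R * R => z.2 * Num.sqrt 2).
    by apply: measurable_funM => //; exact: measurable_snd.
  exact: (mf measurableT _ (mB _)).
pose L := [pred e : 'I_N * 'I_N | (e.2 <= e.1)%N].
pose S : {fset 'I_N * 'I_N} := [fset e in enum L]%fset.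
have SL e : (e \in S) = L e by rewrite inE /= mem_enum.
have LS : [set` S] `<=` [set ij : 'I_N * 'I_N | (ij.2 <= ij.1)%N].
  by move=> e /=; rewrite SL.
have := a_indep LS (fun e _ => mC e).
have -> : \bigcap_(e in [set` S]) (fun t => reim (a e.1 e.2 t)) @^-1` C e =
    \bigcap_e G e @^-1` B e.
  apply/seteqP; split=> t /= tC.
    suff tLe (i j : 'I_N) : (j <= i)%N ->
        B (i, j) (G (i, j) t) /\ B (j, i) (G (j, i) t).
      move=> [i j] _ /=; have [/tLe[]//|/ltnW/tLe[]//] := leqP j i.
    move=> ji; have : [set` S] (i, j) by rewrite /= SL.
    move=> /tC; rewrite /C /=; case: ifPn => [/eqP <-|ij].
      by rewrite /reim /= gue_diagE.
    have {ij}ji : (j < i)%N by rewrite ltn_neqAle ji andbT eq_sym.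
    by rewrite /reim gue_offdiagE// div_sqrt2E /= !divfK.
  move=> [i j] /=; rewrite SL /= => ji.
  rewrite /C /=; case: ifPn => [/eqP <-|ij].
    by rewrite /reim /= gue_diagE; exact: tC.
  have {ij}ji : (j < i)%N by rewrite ltn_neqAle ji andbT eq_sym.
  rewrite /reim gue_offdiagE// div_sqrt2E /= !divfK//.
  by split; exact: tC.
move=> ->.
transitivity (\prod_(e | L e) P ((fun t => reim (a e.1 e.2 t)) @^-1` C e))%E.
  rewrite -big_enum /=; apply: perm_big.
  apply: uniq_perm; rewrite ?fset_uniq ?enum_uniq//.
  by move=> e; rewrite SL mem_enum.
pose w e := P (G e @^-1` B e).
transitivity (\prod_(e | L e) (w e * if e.1 == e.2 then 1 else w (e.2, e.1)))%E.
  apply: eq_bigr => -[i j] /= ji; rewrite /C /=; case: ifPn => [/eqP <-|ij].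
    rewrite mule1; congr (P _); apply/funext => t /=.
    by rewrite /reim gue_diagE.
  have {ij}ji : (j < i)%N by rewrite ltn_neqAle ji andbT eq_sym.
  rewrite -gue_gaussian_pair//; congr (P _); apply/funext => t /=.
  by rewrite /reim gue_offdiagE// div_sqrt2E /= !divfK.
(* the coordinates above the diagonal are the transposes of those below *)
rewrite big_split/= [RHS](bigID L) /=; congr (_ * _)%E.
rewrite (bigID (fun e => e.1 == e.2)) /= big1 ?mul1e; last first.
  by move=> e /andP[_ ->].
rewrite (reindex_inj (h := fun e : 'I_N * 'I_N => (e.2, e.1))) /=; last first.
  by move=> [i j] [i' j'] [-> ->].
apply: eq_big => [[i j]|[i j]] /=.
  by rewrite -ltnNge ltn_neqAle andbC eq_sym.
by move=> /andP[_]; rewrite eq_sym => /negbTE ->.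
Qed.

End gue_gaussians.

(** * The generic GUE matrix and its derivations *)

Section generic_gue.
Variables (R : realType) (N : nat).
Let n := #|{: 'I_N * 'I_N}|.
Implicit Types (e : 'I_N * 'I_N) (i j k l : 'I_N).
Let s : R[i] := ((Num.sqrt 2)^-1)%:C.
Let r : R[i] := ((Num.sqrt N%:R)^-1)%:C.

Definition coordX e : mpoly n R[i] := mpolyX _ (mnm1 (enum_rank e)).
Definition coordD e : mpoly n R[i] -> mpoly n R[i] := mderiv (enum_rank e).

Lemma coordDX e e' : coordD e (coordX e') = (e == e')%:R.
Proof.
rewrite /coordD /coordX mderivX mnm1E (inj_eq enum_rank_inj) eq_sym.
have [->|_] := eqVneq e e'; last by rewrite scale0r.
rewrite scale1r.
have -> : mnm_sub (mnm1 (enum_rank e')) (mnm1 (enum_rank e')) = @mnm0 n.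
  by apply/mnmP => h; rewrite mnmBE subnn mnm0E.
by rewrite mpolyX0.
Qed.

(** The entry a i j is the combination of the coordinates (i, j) and (j, i) with
    coefficients gue_coef1 i j and gue_coef2 i j: below the diagonal it is
    (X + iY)/sqrt 2, above the diagonal the conjugate of the transposed entry. *)
Definition gue_coef1 i j : R[i] :=
  if i == j then 1 else if (j < i)%N then s else - ('i%C * s).
Definition gue_coef2 i j : R[i] :=
  if i == j then 0 else if (j < i)%N then 'i%C * s else s.

Let sqr_s : s * s *+ 2 = 1.
Proof.
rewrite /s -rmorphM -invfM -expr2 sqr_sqrtr// -rmorphMn /=.
by rewrite -mulr_natr mulVf// pnatr_eq0.
Qed.

Let sqr_is : 'i%C * s * ('i%C * s) = - (s * s).
Proof. by rewrite mulrACA -expr2 sqr_i mulN1r. Qed.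

Lemma gue_coef_sqr i j :
  gue_coef1 i j * gue_coef1 i j + gue_coef2 i j * gue_coef2 i j = (i == j)%:R.
Proof.
rewrite /gue_coef1 /gue_coef2.
case: eqVneq => _; first by rewrite mulr1 mulr0 addr0.
by case: ifP => _; rewrite ?mulrNN sqr_is ?subrr ?addNr.
Qed.

Lemma gue_coef_cross i j :
  gue_coef1 i j * gue_coef2 j i + gue_coef2 i j * gue_coef1 j i = (i != j)%:R.
Proof.
rewrite /gue_coef1 /gue_coef2 [j == i]eq_sym; case: eqVneq => [//|ij] /=.
  by rewrite mulr0 mul0r addr0.
have [ji|ij'] := ltnP j i.
  by rewrite ltnNge (ltnW ji) /= mulrN sqr_is opprK -mulr2n sqr_s.
have ij2 : (i < j)%N by rewrite ltn_neqAle ij' andbT.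
by rewrite ij2 mulNr sqr_is opprK -mulr2n sqr_s.
Qed.

Definition gue_poly : 'M[mpoly n R[i]]_N :=
  \matrix_(i, j) (r *: (gue_coef1 i j *: coordX (i, j) +
                        gue_coef2 i j *: coordX (j, i))).

(** The derivation that integration by parts attaches to the entry (i, j): each
    coordinate in the entry is replaced by its partial derivative. *)
Definition gue_deriv i j (p : mpoly n R[i]) : mpoly n R[i] :=
  r *: (gue_coef1 i j *: coordD (i, j) p + gue_coef2 i j *: coordD (j, i) p).

Lemma gue_derivB i j p q :
  gue_deriv i j (p - q) = gue_deriv i j p - gue_deriv i j q.
Proof.
by rewrite /gue_deriv /coordD !mderivB !scalerBr addrACA -opprD scalerBr.
Qed.

HB.instance Definition _ i j :=
  GRing.isZmodMorphism.Build _ _ (gue_deriv i j) (gue_derivB i j).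

Lemma gue_derivM i j p q :
  gue_deriv i j (p * q) = gue_deriv i j p * q + p * gue_deriv i j q.
Proof.
rewrite /gue_deriv /coordD !mderivM -scalerAl -scalerAr -scalerDr; congr (_ *: _).
by rewrite mulrDl mulrDr !scalerDr -!scalerAl -!scalerAr addrACA.
Qed.

(** This is E [A_ij A_kl] = 1/N if (k, l) = (j, i), and 0 otherwise. For i <> j the
    pairing of an entry with itself vanishes since 1 + i^2 = 0
    ([gue_coef_sqr]), and its pairing with the transposed entry is 1
    ([gue_coef_cross]). *)
Lemma gue_deriv_poly i j : (0 < N)%N ->
  map_mx (gue_deriv i j) gue_poly = (N%:R^-1)%:A *: delta_mx j i.
Proof.
move=> N0; apply/matrixP => k l; rewrite !mxE.
rewrite /gue_deriv /coordD.
rewrite !mderivZ !mderivD !mderivZ -!/(coordD _ _) !coordDX !xpair_eqE.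
rewrite [k == j]eq_sym [l == i]eq_sym.
have rr : r * r = N%:R^-1.
  rewrite /r -rmorphM -invfM -expr2 sqr_sqrtr ?ler0n// rmorphV ?rmorph_nat//.
  by rewrite unitfE pnatr_eq0 -lt0n.
have factor (u v u' v' : R[i]) : r *: (u *: (r *: u'%:A) + v *: (r *: v'%:A)) =
    (N%:R^-1 * (u * u' + v * v'))%:A :> mpoly n R[i].
  rewrite -rr !scalerA -scalerDl scalerA; congr (_ *: _); ring.
have scal (u v : R[i]) (b b' : bool) : u *: b%:R + v *: b'%:R =
    (u *+ b + v *+ b')%:A :> mpoly n R[i].
  by rewrite scalerDl -!scalerMnl !scalerMnr.
have nat1 (b : bool) : b%:R = (b%:R : R[i])%:A :> mpoly n R[i].
  by rewrite scaler_nat.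
rewrite !scal factor mulr_algl nat1 scalerA; congr (_ * _ *: _).
have [<-|ij] := eqVneq i j.
  rewrite /gue_coef1 /gue_coef2 eqxx mul1r mul0r addr0 ![(i == l) && _]andbC.
  have [<-|_] := eqVneq i k; last by rewrite /= ?andbF addr0.
  by have [il|_] := eqVneq i l; rewrite /= ?addr0.
have [<-|ik] := eqVneq i k; rewrite /= ?[j == i]eq_sym ?(negbTE ij) ?andbF ?andbT.
  rewrite /= addr0 add0r.
  have [<-|_] := eqVneq j l; last by rewrite /= !mulr0 addr0.
  by rewrite gue_coef_sqr (negbTE ij).
rewrite /= add0r addr0.
have [<-|jk] := eqVneq j k; last by rewrite ?andbF /= !mulr0 addr0.
rewrite /= andbT; have [<-|il] := eqVneq i l; last by rewrite /= !mulr0 addr0.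
by rewrite gue_coef_cross ij.
Qed.

End generic_gue.

(** * Trace moments of a GUE matrix *)

Lemma map_mx_expr (S S' : pzSemiRingType) (f : {rmorphism S -> S'}) n
    (M : 'M[S]_n) k :
  map_mx f (M ^+ k) = map_mx f M ^+ k.
Proof.
elim: k => [|k IHk]; last by rewrite !exprS -!mulmxE map_mxM IHk.
by rewrite !expr0 map_mx1.
Qed.

Section gue_trace_moments.
Context d (T : measurableType d) (R : realType) (P : probability T R).
Variables (N : nat) (A : T -> 'M[R[i]]_N).
Hypotheses (N0 : (0 < N)%N) (gueA : gue P A).
Let n := #|{: 'I_N * 'I_N}|.

Definition trace_product (s : seq nat) t : R[i] :=
  \prod_(r <- s) normalized_trace (A t ^+ r).

Definition trace_moment (s : seq nat) : R[i] :=
  complex_expectation P (trace_product s).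

Lemma gue_poly_model : exists G : 'I_n -> {RV P >-> R},
  [/\ forall k, standard_gaussian (G k),
      forall B : 'I_n -> set R, (forall k, measurable (B k)) ->
        P (\bigcap_k G k @^-1` B k) = (\prod_k P (G k @^-1` B k))%E &
      forall t, A t = map_mx (meval (fun k => (G k t)%:C)) (gue_poly R N)].
Proof.
case: gueA => a [AE aH aI aO aD].
pose G := gue_gaussian aO aD.
exists (fun k => G (enum_val k)); split.
- by move=> k; exact: gue_gaussian_standard.
- move=> B mB.
  have := @gue_gaussian_indep _ _ _ _ _ _ aI aO aD
    (fun e => B (enum_rank e)) (fun e => mB _).
  have -> : \bigcap_e (gue_gaussian aO aD e @^-1` B (enum_rank e)) =
      \bigcap_k (G (enum_val k) @^-1` B k).
    apply/seteqP; split => t tB k _ /=.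
      by have := tB (enum_val k) I; rewrite /= enum_valK.
    by have := tB (enum_rank k) I; rewrite /= enum_rankK.
  move=> ->; rewrite (reindex (fun k : 'I_n => enum_val k)) /=.
    by apply: eq_bigr => k _; rewrite enum_valK.
  exists enum_rank => e _; [exact: enum_valK|exact: enum_rankK].
move=> t; rewrite AE; apply/matrixP => i j; rewrite !mxE mevalZ; congr (_ * _).
rewrite mevalD !mevalZ !mevalXU !enum_rankK /gue_coef1 /gue_coef2.
have [<-|ij] := eqVneq i j.
  by rewrite mul1r mul0r addr0 (gue_diagE aO aD).
have sC (x y : R) : (x +i* y) / (Num.sqrt 2)%:C =
   ((Num.sqrt 2)^-1)%:C * x%:C + 'i%C * ((Num.sqrt 2)^-1)%:C * y%:C.
  rewrite div_sqrt2E; apply/eqP; rewrite eq_complex /=.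
  by apply/andP; split; apply/eqP; ring.
have sH (x y : R) : conjc ((x +i* y) / (Num.sqrt 2)%:C) =
   ((Num.sqrt 2)^-1)%:C * x%:C - 'i%C * ((Num.sqrt 2)^-1)%:C * y%:C.
  rewrite div_sqrt2E; apply/eqP; rewrite eq_complex /=.
  by apply/andP; split; apply/eqP; ring.
have [ji|ij'] := ltnP j i; first by rewrite (gue_offdiagE aO aD)// sC.
have ij2 : (i < j)%N by rewrite ltn_neqAle ij' andbT.
by rewrite aH (gue_offdiagE aO aD)// sH mulNr addrC.
Qed.

(** The loop equation for the generic GUE matrix, with c = 1/N, after division of
    each trace by N. The terms with two traces have one trace more than the
    left-hand side, the others have one trace less, hence the factor N^-2. *)
Lemma gue_trace_moments :
  [/\ forall s, complex_integrable P (trace_product s),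
      trace_moment [::] = 1,
      forall s, trace_moment (0%N :: s) = trace_moment s &
      forall k s, trace_moment (k.+1 :: s) =
        \sum_(l < k) trace_moment [:: val l, (k.-1 - l)%N & s] +
        N%:R ^- 2 * \sum_(i < size s)
          trace_moment ((k + (nth 0 s i).-1)%N :: take i s ++ drop i.+1 s)
            *+ nth 0%N s i].
Proof.
have [G [gG iG AE]] := gue_poly_model.
pose M := gue_poly R N.
pose Q (s : seq nat) := \prod_(r <- s) \tr (M ^+ r).
pose Ex := @poly_expectation _ _ _ P n G.
have C0 : N%:R != 0 :> R[i] by rewrite pnatr_eq0 -lt0n.
have prodE s : trace_product s = fun t => N%:R ^- size s *
    meval (fun k => (G k t)%:C) (Q s).
  apply/funext => t; rewrite /trace_product rmorph_prod /=.
  elim: s => [|r s IHs]; first by rewrite !big_nil expr0 invr1 mulr1.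
  rewrite !big_cons IHs /normalized_trace AE -map_mx_expr trace_map_mx.
  by rewrite /= exprSr invfM; ring.
have [iQ mQ] : (forall s, complex_integrable P (trace_product s)) /\
    forall s, trace_moment s = N%:R ^- size s * Ex (Q s).
  by split=> s; rewrite /trace_moment prodE;
    have [] := complex_expectationZ (N%:R ^- size s) (poly_integrable gG iG (Q s)).
split=> //.
- rewrite mQ /Q big_nil /= expr0 invr1 mul1r /Ex.
  rewrite -(mpolyX0 n) (poly_expectationX gG iG _).2 big1// => k _.
  by rewrite mnm0E gaussian_moment0.
- move=> s; rewrite !mQ /Q big_cons expr0 /= mxtrace1 exprS invfM.
  have ExN q : Ex (N%:R * q) = N%:R * Ex q.
    by rewrite mulr_natl -scaler_nat; exact: poly_expectationZ.
  by rewrite ExN mulrACA mulVf// mul1r.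
move=> k s; rewrite mQ /Q big_cons.
have ibp i j p : Ex (M i j * p) = Ex (gue_deriv i j p).
  rewrite /M mxE /gue_deriv -!scalerAl mulrDl -!scalerAl /Ex.
  rewrite !(poly_expectationZ gG iG) !(poly_expectationD gG iG).
  rewrite !(poly_expectationZ gG iG).
  by rewrite !(gaussian_ibp gG iG).
have loop := @loop_equation _ _ _ M Ex
  (fun i j => gue_deriv i j : {additive mpoly n R[i] -> mpoly n R[i]}) N%:R^-1
   (@gue_derivM R N) (fun i j => gue_deriv_poly R i j N0)
   (poly_expectationD gG iG) (poly_expectationZ gG iG) ibp.
rewrite loop; set S1 := \sum_(l < k) _; set S2 := \sum_(i < size s) _.
have -> : \sum_(l < k) trace_moment [:: val l, (k.-1 - l)%N & s] =
    N%:R ^- (size s).+2 * S1.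
  by rewrite mulr_sumr; apply: eq_bigr => l _; rewrite mQ.
have -> : \sum_(i < size s)
      trace_moment ((k + (nth 0 s i).-1)%N :: take i s ++ drop i.+1 s)
            *+ nth 0%N s i = N%:R ^- size s * S2.
  rewrite mulr_sumr; apply: eq_bigr => i _; rewrite mQ mulrnAr.
  congr (_ ^- _ * _ *+ _).
  rewrite /= size_cat size_take size_drop ltn_ord.
  by rewrite -addnS -subSn// subSS subnKC// ltnW.
by rewrite -!exprVn /= !exprS; ring.
Qed.

End gue_trace_moments.

(** * The limit *)

(** A positive complex number is real, so that balls around real points restrict
    to balls of the real line. *)
Lemma cvg_real_complex (R : realType) (u : nat -> R) (l : R) :
  u n @[n --> \oo] --> l ->
  ((u n)%:C : (R[i] : numFieldType)) @[n --> \oo] --> (l%:C : (R[i] : numFieldType)).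
Proof.
move=> /cvgrPdist_lt ul; apply/cvgrPdist_lt => e e0.
have eE : e = (complex.Re e)%:C.
  by move: e0; case: (e) => x y; rewrite ltcE /= => /andP[/eqP ->].
have e0' : 0 < complex.Re e by rewrite -ltcR -eE.
near=> n; rewrite -rmorphB /= normc_def /= expr0n addr0 sqrtr_sqr eE ltcR.
by near: n; exact: ul.
Unshelve. all: end_near. Qed.

(** Induction on the total degree, and for a given degree on the number of
    entries, which removes leading zeros. For a positive leading entry all terms
    of the recursion have smaller degree: the first sum tends to
    (sum_l c_l c_(k-1-l)) times the product over s, which is c_(k+1) times this
    product, and the second sum converges, hence is killed by eps. *)
Lemma loop_recursion_limit (F : numFieldType) (mu : nat -> seq nat -> F)
    (eps : nat -> F) (c : nat -> F) :
  c 0%N = 1 -> c 1%N = 0 ->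
  (forall k, c k.+2 = \sum_(j < k.+1) c j * c (k - j)%N) ->
  eps N @[N --> \oo] --> 0 ->
  (forall N, (0 < N)%N -> mu N [::] = 1) ->
  (forall N s, (0 < N)%N -> mu N (0%N :: s) = mu N s) ->
  (forall N k s, (0 < N)%N -> mu N (k.+1 :: s) =
     \sum_(l < k) mu N [:: val l, (k.-1 - l)%N & s] +
     eps N * \sum_(i < size s)
       mu N ((k + (nth 0 s i).-1)%N :: take i s ++ drop i.+1 s)
         *+ nth 0%N s i) ->
  forall s, mu N s @[N --> \oo] --> \prod_(r <- s) c r.
Proof.
move=> c0 c1 cS eps0 mu_nil mu0 muS.
have near_pos : \forall N \near \oo, (0 < N)%N by exists 1%N.
suff H b s : (sumn s < b)%N -> mu N s @[N --> \oo] --> \prod_(r <- s) c r.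
  by move=> s; exact: (H (sumn s).+1).
elim: b s => [//|b IHb].
elim=> [_|[|k] s IHs] /=.
- rewrite big_nil; apply: cvg_near_cst.
  by apply: filterS near_pos => N; exact: mu_nil.
- move=> sb; rewrite big_cons c0 mul1r.
  apply: cvg_trans (IHs sb); apply: near_eq_cvg.
  by apply: filterS near_pos => N N0; rewrite mu0.
rewrite addSn ltnS => sb; rewrite big_cons.
have -> : c k.+1 * \prod_(r <- s) c r =
    \sum_(l < k) \prod_(r <- [:: val l, (k.-1 - l)%N & s]) c r +
    0 * \sum_(i < size s)
      (\prod_(r <- (k + (nth 0 s i).-1)%N :: take i s ++ drop i.+1 s) c r)
        *+ nth 0%N s i.
  rewrite mul0r addr0; case: k {sb} => [|k].
    by rewrite c1 mul0r big_ord0.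
  rewrite cS mulr_suml; apply: eq_bigr => l _.
  by rewrite !big_cons mulrA.
apply: (@cvg_trans _ ((\sum_(l < k) mu N [:: val l, (k.-1 - l)%N & s] +
     eps N * \sum_(i < size s)
       mu N ((k + (nth 0 s i).-1)%N :: take i s ++ drop i.+1 s)
         *+ nth 0%N s i) @[N --> \oo])).
  by apply: near_eq_cvg; apply: filterS near_pos => N N0; rewrite muS.
apply: cvgD.
  apply: cvg_big => [|l _]; [exact: add_continuous|apply: IHb => /=].
  have k0 : (0 < k)%N by exact: leq_ltn_trans (ltn_ord l).
  rewrite addnA subnKC; last by rewrite -ltnS prednK.
  by apply: leq_ltn_trans sb; rewrite leq_add2r leq_pred.
apply: cvgM => //; apply: cvg_big => [|i _]; first exact: add_continuous.
under eq_fun do rewrite -mulr_natr; rewrite -mulr_natr.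
apply: cvgM; last exact: cvg_cst.
apply: IHb; apply: leq_ltn_trans sb; rewrite /= -addnA leq_add2l sumn_cat.
have -> : sumn s = (sumn (take i s) + (nth 0 s i + sumn (drop i.+1 s)))%N.
  by rewrite -{1}(cat_take_drop i s) sumn_cat (drop_nth 0%N).
by rewrite addnCA leq_add2l leq_add2r leq_pred.
Qed.

Theorem theorem2p21 (R : realType) (d : nat -> measure_display)
    (T : forall N : nat, measurableType (d N))
    (P : forall N : nat, probability (T N) R)
    (A : forall N : nat, T N -> 'M[R[i]]_N)
    (hA : forall N : nat, (0 < N)%N -> gue (P N) (A N))
    (m : nat) :
  (forall N : nat, (0 < N)%N ->
     complex_integrable (P N) (fun t => normalized_trace (A N t ^+ m))) /\
  (fun N : nat =>
     complex_expectation (P N) (fun t => normalized_trace (A N t ^+ m))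
       : (R[i] : numFieldType)) @ \oo -->
  ((1 / (2 * pi) *
    \int[lebesgue_measure]_(x in `[(-2 : R), 2]) (x ^+ m * Num.sqrt (4 - x ^+ 2)))%:C
     : (R[i] : numFieldType)).
Proof.
have trE N t : normalized_trace (A N t ^+ m) = trace_product (A N) [:: m] t.
  by rewrite /trace_product big_seq1.
split=> [N N0|].
  under eq_fun do rewrite trE.
  by have [iT _ _ _] := gue_trace_moments N0 (hA N N0); exact: iT.
under eq_fun do under eq_fun do rewrite trE.
pose mu N := trace_moment (P N) (A N).
have := @loop_recursion_limit R[i] mu (fun N => N%:R ^- 2)
  (fun k => (semicircle_moment R k)%:C) _ _ _ _ _ _ _ [:: m].
rewrite big_seq1; apply.
- by have [-> _ _] := semicircle_moment_conv R 0.
- by have [_ -> _] := semicircle_moment_conv R 0.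
- move=> k; have [_ _ ->] := semicircle_moment_conv R k.
  by rewrite rmorph_sum; apply: eq_bigr => j _; rewrite rmorphM.
- have -> : (fun N => N%:R ^- 2) = (fun N => (N%:R ^- 2)%:C) :> (nat -> R[i]).
    by apply/funext => N; rewrite (fmorphV (real_complex R)) rmorphXn /= rmorph_nat.
  apply: cvg_real_complex.
  have V0 : (fun N : nat => N%:R^-1 : R) @ \oo --> (0 : R).
    by rewrite -cvg_shiftS; exact: cvg_harmonic.
  under eq_fun do rewrite -exprVn expr2.
  by rewrite -[0](mulr0 (0 : R)); exact: cvgM.
- by move=> N N0; have [_ ? _ _] := gue_trace_moments N0 (hA N N0).
- by move=> N s N0; have [_ _ e _] := gue_trace_moments N0 (hA N N0); exact: e.
- by move=> N k s N0; have [_ _ _ e] := gue_trace_moments N0 (hA N N0); exact: e.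
Qed.
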